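(* There exist absolute constants $\kappa_1,\kappa_2>0$ such that for all $c_1\ge\kappa_1$, $c_2\ge\kappa_2$ and every $\rho>0$ there exists a constant $C>0$, depending only on $\rho,c_1,c_2$, with the following property. For all integers $N\ge1$ and $r\ge2$, with $n=2^N$, and every mean matrix $s$ such that $s_i^{(j)}\le1-\rho$ for all $i\in\{1,\dots,n\}$, $j\in\{1,\dots,r\}$, the estimator $\tilde s$ computed with the EH strategy (with constants $c_1,c_2$ in the penalty) satisfies $$\mathbb{E}_s\|s-\tilde s\|^2\le C\,\log n\,\inf_{m\in\mathcal{M}}\mathbb{E}_s\|s-\hat s_m\|^2 .$$
   Context: Model. $n=2^N$ with an integer $N\ge1$, and $r\ge2$ is an integer. $X_1,\dots,X_n$ are independent random column vectors, $X_i\in\{0,1\}^r$ with components summing to one. $X$ is the $r\times n$ random matrix with $i$th column $X_i$ and $s$ is its expectation (so each column of $s$ is a probability on $\{1,\dots,r\}$, and $s$ determines the law of $X$). $\mathbb{P}_s,\mathbb{E}_s$ denote probability and expectation when the mean of $X$ is $s$. For an $r\times n$ matrix $t$, $t^{(j)}$ is its $j$th line (a vector of $\mathbb{R}^n$), $t_i$ its $i$th column, $t_i^{(j)}$ its $(j,i)$ entry; $\langle t,t'\rangle=\sum_{i,j}t_i^{(j)}t_i'^{(j)}$ and $\|\cdot\|$ is the associated norm. For a linear subspace $S\subset\mathbb{R}^n$, $\mathbb{R}^r\otimes S$ is the set of $r\times n$ matrices all of whose lines belong to $S$. Haar basis. $\Lambda=\bigcup_{j=-1}^{N-1}\Lambda(j)$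 where $\Lambda(-1)=\{(-1,0)\}$ and $\Lambda(j)=\{(j,k):k=0,\dots,2^j-1\}$ for $j\ge0$. Let $\varphi:\mathbb{R}\to\{-1,0,1\}$ equal $1$ on $(0,1/2]$, $-1$ on $(1/2,1]$ and $0$ elsewhere. For $\lambda\in\Lambda$, $\phi_\lambda\in\mathbb{R}^n$ has $i$th component $1/\sqrt n$ if $\lambda=(-1,0)$ and $\frac{2^{j/2}}{\sqrt n}\varphi\left(2^j\frac in-k\right)$ if $\lambda=(j,k)$ with $j\ge0$. $\{\phi_\lambda,\lambda\in\Lambda\}$ is an orthonormal basis of $\mathbb{R}^n$. Penalized estimator. Given a finite collection $\{S_m,m\in\mathcal{M}\}$ of linear subspaces of $\mathbb{R}^n$ with $D_m=\dim S_m$ and a penalty $\mathrm{pen}:\mathcal{M}\to\mathbb{R}_+$, $\hat s_m$ is the orthogonal projection of $X$ onto $\mathbb{R}^r\otimes S_m$, $\gamma_n(t)=\|t\|^2-2\langle X,t\rangle$, and $\tilde s=\hat s_{\hat m}$ where $\hat m$ minimizes $\gamma_n(\hat s_m)+\mathrm{pen}(m)$ over $m\in\mathcal{M}$. EH strategy. $\mathcal{M}$ is the collection of all subsets of $\Lambda$ that contain $(-1,0)$; $S_m$ is the linear span of $\{\phi_\lambda,\lambda\in m\}$, so $D_m=|m|$; and $\mathrm{pen}(m)=D_m\left(c_1\log\left(\frac{n}{D_m}\right)+c_2\right)$. *)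

(* Defs.v *)
From mathcomp Require Export all_boot all_order all_algebra.
From mathcomp Require Export all_classical all_reals all_analysis.
Export Order.TTheory GRing.Theory Num.Theory.
Export numFieldNormedType.Exports.

Set Implicit Arguments.
Unset Strict Implicit.
Unset Printing Implicit Defensive.

#[global] Open Scope classical_set_scope.
#[global] Open Scope ring_scope.

Definition minner (R : realType) (r n : nat) (t u : 'M[R]_(r, n)) : R :=
  \sum_(j < r) \sum_(i < n) t j i * u j i.

(* Not the canonical [`|t|] on matrices, which is the sup norm. *)
Definition mnorm (R : realType) (r n : nat) (t : 'M[R]_(r, n)) : R :=
  Num.sqrt (minner t t).

(* R^r (x) S *)
Definition tensor_space (R : realType) (r n : nat) (S : {vspace 'rV[R]_n}) :
    set 'M[R]_(r, n) :=
  [set t | forall j : 'I_r, row j t \in S].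

(* The projection exists and is unique when [V] is a linear subspace; the
   default value 0 of [xget] is then irrelevant. *)
Definition orth_proj (R : realType) (r n : nat) (V : set 'M[R]_(r, n))
    (x : 'M[R]_(r, n)) : 'M[R]_(r, n) :=
  xget 0 [set p | V p /\ forall t, V t -> minner (x - p) t = 0].

Definition gamma_n (R : realType) (r n : nat) (x t : 'M[R]_(r, n)) : R :=
  mnorm t ^+ 2 - 2 * minner x t.

Definition shat (R : realType) (r n : nat) (M : finType)
    (S : M -> {vspace 'rV[R]_n}) (m : M) (x : 'M[R]_(r, n)) : 'M[R]_(r, n) :=
  orth_proj (tensor_space (S m)) x.

(* [mhat] is a data-dependent choice of one minimizer of the penalized
   criterion; how ties are broken is left free. *)
Definition penalized_selector (R : realType) (r n : nat) (M : finType)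
    (S : M -> {vspace 'rV[R]_n}) (pen : M -> R)
    (mhat : 'M[R]_(r, n) -> M) : Prop :=
  forall (x : 'M[R]_(r, n)) (m : M),
    gamma_n x (shat S (mhat x) x) + pen (mhat x) <= gamma_n x (shat S m x) + pen m.

Definition penalized_estimator (R : realType) (r n : nat) (M : finType)
    (S : M -> {vspace 'rV[R]_n}) (mhat : 'M[R]_(r, n) -> M)
    (x : 'M[R]_(r, n)) : 'M[R]_(r, n) :=
  shat S (mhat x) x.

(* [None] stands for (-1, 0), and [Some (existT _ j k)] for (j, k), where
   0 <= j < N and 0 <= k < 2 ^ j. *)
Definition haar_index (N : nat) : finType :=
  option {j : 'I_N & 'I_(2 ^ j)}.

Definition haar_mother (R : realType) (x : R) : R :=
  if (0 < x) && (x <= 1 / 2) then 1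
  else if (1 / 2 < x) && (x <= 1) then -1
  else 0.

(* Components are numbered from 1 in the formula, hence [i.+1]. *)
Definition haar_vector (R : realType) (N : nat) (l : haar_index N) :
    'rV[R]_(2 ^ N) :=
  let n : R := (2 ^ N)%N%:R in
  \row_i
    match l with
    | None => 1 / Num.sqrt n
    | Some (existT j k) =>
        2 `^ (j%:R / 2) / Num.sqrt n
        * haar_mother (2 ^+ j * (i.+1%:R / n) - k%:R)
    end.

Definition eh_model (N : nat) : finType :=
  {m : {set haar_index N} | None \in m}.

Definition eh_space (R : realType) (N : nat) (m : eh_model N) :
    {vspace 'rV[R]_(2 ^ N)} :=
  <<[seq haar_vector R l | l in val m]>>%VS.

Definition eh_pen (R : realType) (N : nat) (c1 c2 : R) (m : eh_model N) : R :=
  let D : R := (\dim (eh_space R m))%:R in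
  D * (c1 * ln ((2 ^ N)%N%:R / D) + c2).

Definition mutually_independent (d : measure_display) (T : measurableType d)
    (R : realType) (P : probability T R) (I : finType)
    (F : I -> set (set T)) : Prop :=
  forall (J : {set I}) (A : I -> set T),
    (forall i, i \in J -> F i (A i)) ->
    P (\bigcap_(i in [set` J]) A i) = (\prod_(i in J) P (A i))%E.

Definition random_mx (d : measure_display) (T : measurableType d)
    (R : realType) (P : probability T R) (r n : nat)
    (X : 'I_r -> 'I_n -> {RV P >-> R}) (w : T) : 'M[R]_(r, n) :=
  \matrix_(j, i) X j i w.

(* Independence of the columns is that of the sigma-algebras they generate. *)
Definition categorical_sample (d : measure_display) (T : measurableType d)
    (R : realType) (P : probability T R) (r n : nat)
    (X : 'I_r -> 'I_n -> {RV P >-> R}) (s : 'M[R]_(r, n)) : Prop :=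
  [/\ forall w j i, X j i w = 0 \/ X j i w = 1,
      forall w i, \sum_(j < r) X j i w = 1,
      mutually_independent P
        (fun i : 'I_n => g_sigma_preimage (fun j : 'I_r => X j i : T -> R)) &
      forall j i, ('E_P[X j i] = (s j i)%:E)%E].

Definition risk (d : measure_display) (T : measurableType d)
    (R : realType) (P : probability T R) (r n : nat)
    (X : 'I_r -> 'I_n -> {RV P >-> R}) (s : 'M[R]_(r, n))
    (e : 'M[R]_(r, n) -> 'M[R]_(r, n)) : \bar R :=
  ('E_P[fun w => (mnorm (s - e (random_mx X w)) ^+ 2)%R])%E.

(* Main.v *)
Require Import Defs.
From mathcomp Require Import measurable_realfun ring lra zify.

(** Write n = 2^N, let phi_l run over the Haar vectors, let eps = X - s be the
    noise, Z_l = |eps phi_l|^2 and b_l = |s phi_l|^2.  In this orthonormal basis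
    everything decouples: the loss of a model m is the sum of the b_l outside m
    plus the sum of the Z_l inside m, and the criterion at m is
    pen(m) - sum_(l in m) |X phi_l|^2.  The bound s <= 1 - rho gives
    rho <= E Z_l <= 1 ([law_mean_energy_bounds]), so a fixed model has risk at
    least bias(m) + rho D_m, and pen(m) exceeds this by a factor of order log n
    at most.  Comparing the criterion at the selected model mh and at m, one
    basis vector at a time ([selection_deterministic]), bounds the loss by
    5 bias(m) + 2 sum_(l in m) Z_l + 2 pen(m) and the single random term
    5 sum_(l in mh) Z_l - 2 pen(mh), which must be O(log n) in mean although mh
    ranges over exponentially many models.

    The uniformity comes from convexity, not from a union bound.  With
    theta = 1/64, the convexity inequality x <= e^x / y + ln y at x = theta Z_l and
    y = n / D gives, for every model of dimension D,
      theta sum_(l in m) Z_l <= D ln (n / D) + (D / n) W,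
    where W = sum_l e^(theta Z_l) runs over the whole basis and does not depend
    on m ([sum_energy_le]).  The first term is absorbed by c1.  The mean of W is
    at most 2 n, and (D / n) (W - E W) <= D + (W - E W)^2 / (4 n), so that both
    are absorbed by c2 up to Var W / n.  Haar vectors of one level have disjoint
    supports, hence their Z_l are independent and the sum of e^(theta Z_l) over
    a level has variance at most twice the size of the level; the Cauchy-Schwarz
    inequality across the N + 1 levels gives Var W <= 2 (N + 1) n
    ([law_mean_exp_energy_dev_sq]), which is where a logarithm of n is lost.

    The variance bound requires an exponential moment of Z_l that is free of the
    number r of categories: E e^(Z_l / 32) <= 2
    ([law_mean_expR_noise_energy]).  It is obtained by integrating out one
    column of the noise at a time, which leaves an exponential of a quadratic
    form of the same shape with a slightly larger coefficient.

    All expectations reduce to finite sums, because a 0-1 matrix with columns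
    summing to one is a function from columns to categories, and the columns are
    drawn from a product law ([expectation_sample]). *)

Set Implicit Arguments.
Unset Strict Implicit.
Unset Printing Implicit Defensive.

(** * Two inequalities on the exponential *)

Section ExponentialInequalities.
Context {R : realType}.
Implicit Types x y : R.

(** For a centred bounded variable Y this turns E e^Y into E e^(2 Y^2), which is
    a Gaussian-type bound on its Laplace transform. *)
Lemma expR_le_addR_expR_sqr x : expR x <= x + expR (2 * x ^+ 2).
Proof.
have [xle|xgt] := leP x (1 / 2).
(* e^(-x) >= 1 - x, then 1 / (1 - x) <= 1 + x + 2 x^2 for x <= 1/2 *)
- have h1 : 1 - x <= (expR x)^-1 by rewrite -expRN expR_ge1Dx.
  have h2 : expR x <= (1 - x)^-1.
    rewrite -[expR x]invrK lef_pV2 ?posrE ?invr_gt0 ?expR_gt0 //; lra.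
  have h3 : (1 - x)^-1 <= x + (1 + 2 * x ^+ 2).
    have p : 0 < 1 - x by lra.
    rewrite -[leLHS]mul1r ler_pdivrMr //.
    have -> : (x + (1 + 2 * x ^+ 2)) * (1 - x) = 1 + x ^+ 2 * (1 - 2 * x) by ring.
    rewrite lerDl mulr_ge0 ?sqr_ge0 //; lra.
  apply: (le_trans h2); apply: (le_trans h3); rewrite lerD2l.
  exact: expR_ge1Dx.
(* here x <= 2 x^2 *)
- apply: (@le_trans _ _ (expR (2 * x ^+ 2))); last by rewrite lerDr; lra.
  by rewrite ler_expR; nra.
Qed.

(** Fenchel-Young inequality between [expR] and its conjugate: the tangent to
    [expR] at ln y lies below it. *)
Lemma ler_expR_ln x y : 0 < y -> x <= y^-1 * expR x + ln y.
Proof.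
move=> y0; have := expR_ge1Dx (x - ln y).
rewrite expRD expRN lnK ?posrE // => h; lra.
Qed.

End ExponentialInequalities.

(** * Finite product laws *)

Section ProductLaw.
Context {R : realType} {I J : finType} (p : J -> I -> R).
Hypothesis p_ge0 : forall j i, 0 <= p j i.
Hypothesis p_sum1 : forall i, \sum_j p j i = 1.
Implicit Types (f h : {ffun I -> J}) (g k : {ffun I -> J} -> R) (A B : {set I}).

Definition law_weight f : R := \prod_i p (f i) i.

Definition law_mean g : R := \sum_f law_weight f * g f.

Local Notation E := law_mean.

Lemma law_weight_ge0 f : 0 <= law_weight f.
Proof. exact: prodr_ge0. Qed.

Lemma eq_law_mean g k : g =1 k -> E g = E k.
Proof. by move=> gk; apply: eq_bigr => f _; rewrite gk. Qed.

Lemma law_meanD g k : E (fun f => g f + k f) = E g + E k.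
Proof. by rewrite -big_split; apply: eq_bigr => f _; rewrite mulrDr. Qed.

Lemma law_meanZ c g : E (fun f => c * g f) = c * E g.
Proof. by rewrite [RHS]mulr_sumr; apply: eq_bigr => f _; rewrite mulrCA. Qed.

Lemma law_mean_sum (K : finType) (P : pred K) (g : K -> {ffun I -> J} -> R) :
  E (fun f => \sum_(a | P a) g a f) = \sum_(a | P a) E (g a).
Proof. by rewrite exchange_big; apply: eq_bigr => f _; rewrite mulr_sumr. Qed.

Lemma ler_law_mean g k : (forall f, g f <= k f) -> E g <= E k.
Proof.
by move=> gk; apply: ler_sum => f _; rewrite ler_wpM2l ?law_weight_ge0.
Qed.

Lemma law_mean_prod (u : I -> J -> R) :
  E (fun f => \prod_i u i (f i)) = \prod_i \sum_j p j i * u i j.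
Proof.
by rewrite bigA_distr_bigA; apply: eq_bigr => f _; rewrite big_split.
Qed.

Lemma law_mean_coord i (u : J -> R) :
  E (fun f => u (f i)) = \sum_j p j i * u j.
Proof.
transitivity (E (fun f => \prod_i' (if i' == i then u (f i') else 1))).
  by apply: eq_law_mean => f; rewrite -big_mkcond big_pred1_eq.
rewrite (law_mean_prod (fun i' j => if i' == i then u j else 1)).
rewrite (bigD1 i) //= eqxx [X in _ * X]big1 ?mulr1 // => i' /negPf ->.
by rewrite -[RHS](p_sum1 i'); apply: eq_bigr => j _; rewrite mulr1.
Qed.

Lemma law_mean_cst c : E (fun=> c) = c.
Proof.
rewrite -[c in LHS]mulr1 law_meanZ.
transitivity (c * E (fun f => \prod_(i : I) 1)).
  by congr (_ * _); apply: eq_law_mean => f; rewrite big1.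
rewrite (law_mean_prod (fun _ _ => 1)) big1 ?mulr1 // => i _.
by rewrite -[RHS](p_sum1 i); apply: eq_bigr => j _; rewrite mulr1.
Qed.

Lemma law_meanB g k : E (fun f => g f - k f) = E g - E k.
Proof.
rewrite law_meanD; congr (_ + _); rewrite -mulN1r -law_meanZ.
by apply: eq_law_mean => f; rewrite mulN1r.
Qed.

Definition splice A f h : {ffun I -> J} :=
  [ffun i => if i \in A then f i else h i].

(** Exchanging the coordinates outside A between two independent draws is an
    involution that preserves the joint weight.  Independence of disjoint blocks
    and the integration of a single coordinate both follow from this. *)
Lemma law_mean_splice A g : E (fun f => E (fun h => g (splice A f h))) = E g.
Proof.
pose sw (fh : {ffun I -> J} * {ffun I -> J}) :=
  (splice A fh.1 fh.2, splice A fh.2 fh.1).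
have swK : involutive sw.
  by move=> [f h]; congr pair; apply/ffunP => i; rewrite !ffunE /=; case: (i \in A).
have swE f h : law_weight (splice A f h) * law_weight (splice A h f) =
    law_weight f * law_weight h.
  rewrite /law_weight -!big_split; apply: eq_bigr => i _ /=; rewrite !ffunE.
  by case: ifP => // _; rewrite mulrC.
transitivity (\sum_f \sum_h
    law_weight f * law_weight h * g (splice A f h)).
  apply: eq_bigr => f _; rewrite mulr_sumr.
  by apply: eq_bigr => h _; rewrite mulrA.
rewrite pair_bigA (reindex_inj (inv_inj swK)) /=.
transitivity (\sum_f \sum_h law_weight f * law_weight h * g f).
  rewrite pair_bigA; apply: eq_bigr => -[f h] _ /=; rewrite swE; congr (_ * g _).
  by apply/ffunP => i; rewrite !ffunE; case: (i \in A).
apply: eq_bigr => f _; rewrite -[RHS](law_mean_cst).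
by apply: eq_bigr => h _; ring.
Qed.

Definition depends_on A g := forall f h, {in A, f =1 h} -> g f = g h.

Lemma law_mean_indep A B g k : (forall i, i \in A -> i \notin B) ->
  depends_on A g -> depends_on B k -> E (fun f => g f * k f) = E g * E k.
Proof.
move=> dAB gA kB; rewrite -(law_mean_splice A).
transitivity (E (fun f => g f * E k)).
  apply: eq_law_mean => f; rewrite -law_meanZ; apply: eq_law_mean => h.
  congr (_ * _); first by apply: gA => i iA; rewrite ffunE iA.
  by apply: kB => i iB; rewrite ffunE ifN //; apply/negP => /dAB; rewrite iB.
rewrite mulrC -law_meanZ; apply: eq_law_mean => f; exact: mulrC.
Qed.

End ProductLaw.

(** * Noise coefficients: moments and exponential moments *)

(** Nonnegativity of the sum of the squares of B a - C b, where B is the sum of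
    the b^2 and C the inner product. *)
Lemma cauchy_schwarz_sum (R : realType) (K : finType) (a b : K -> R) :
  (\sum_k a k * b k) ^+ 2 <= (\sum_k a k ^+ 2) * (\sum_k b k ^+ 2).
Proof.
set A := \sum_k a k ^+ 2; set B := \sum_k b k ^+ 2; set C := \sum_k a k * b k.
have [B0|B0] := eqVneq B 0.
  have b0 k : b k = 0.
    apply/eqP; rewrite -sqrf_eq0; apply/eqP; move/eqP: B0.
    by rewrite psumr_eq0 => [/allP/(_ k)/(_ (mem_index_enum _))/eqP|? _]; rewrite ?sqr_ge0.
  by rewrite B0 mulr0 /C big1 ?expr0n // => k _; rewrite b0 mulr0.
have Bgt0 : 0 < B by rewrite lt0r B0 sumr_ge0 // => k _; rewrite sqr_ge0.
have : 0 <= \sum_k (B * a k - C * b k) ^+ 2.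
  by apply: sumr_ge0 => k _; rewrite sqr_ge0.
have -> : \sum_k (B * a k - C * b k) ^+ 2 = B * (A * B - C ^+ 2).
  transitivity (\sum_k (B ^+ 2 * a k ^+ 2 + (C ^+ 2 * b k ^+ 2 - 2 * B * C * (a k * b k)))).
    by apply: eq_bigr => k _; ring.
  by rewrite big_split /= sumrB -!mulr_sumr -/A -/B -/C; ring.
by rewrite pmulr_rge0 // subr_ge0.
Qed.

Section Noise.
Context {R : realType} {I J : finType} (p : J -> I -> R).
Hypothesis p_ge0 : forall j i, 0 <= p j i.
Hypothesis p_sum1 : forall i, \sum_j p j i = 1.
Implicit Types (f h : {ffun I -> J}) (a : I -> R) (s : seq I) (i : I) (j : J).

Local Notation E := (law_mean p).

Definition noise j i f : R := (f i == j)%:R - p j i.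

Lemma noise_depends j i : depends_on [set i]%SET (noise j i).
Proof. by move=> f h fh; rewrite /noise fh ?inE. Qed.

Lemma sum_kronecker (u : J -> R) j i :
  \sum_j' p j' i * (u j' * (j' == j)%:R) = p j i * u j.
Proof.
rewrite (bigD1 j) //= eqxx mulr1 big1 ?addr0 // => j' /negPf ->.
by rewrite !mulr0.
Qed.

Lemma law_mean_noise j i : E (noise j i) = 0.
Proof.
rewrite (law_mean_coord p_sum1 i (fun j' => (j' == j)%:R - p j i)).
under eq_bigr do rewrite mulrBr.
rewrite sumrB -mulr_suml p_sum1 mul1r.
by have := sum_kronecker (fun=> 1) j i; under eq_bigr do rewrite mul1r; move=> ->; ring.
Qed.

Lemma prob_le1 j i : p j i <= 1.
Proof. by rewrite -(p_sum1 i) (bigD1 j) //= lerDl sumr_ge0. Qed.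

Lemma law_mean_noiseM j i i' :
  E (fun f => noise j i f * noise j i' f) = (i == i')%:R * (p j i - p j i ^+ 2).
Proof.
have [<-|ii'] := eqVneq i i'; last first.
  rewrite (law_mean_indep p_sum1 _ (@noise_depends j i) (@noise_depends j i')) ?mul0r.
    by rewrite law_mean_noise mul0r.
  by move=> k; rewrite !inE => /eqP ->.
rewrite mul1r.
rewrite (law_mean_coord p_sum1 i (fun j' => ((j' == j)%:R - p j i) * ((j' == j)%:R - p j i))).
transitivity (\sum_j' (p j' i * ((1 - 2 * p j i) * (j' == j)%:R) + p j' i * p j i ^+ 2)).
  by apply: eq_bigr => j' _; case: (j' == j) => /=; ring.
rewrite big_split /= -mulr_suml p_sum1 (sum_kronecker (fun=> 1 - 2 * p j i)); ring.
Qed.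

Lemma sum_noise_sq_le2 i f : \sum_j noise j i f ^+ 2 <= 2.
Proof.
apply: (@le_trans _ _ (\sum_j ((j == f i)%:R + p j i))).
  apply: ler_sum => j _; rewrite /noise eq_sym.
  have := p_ge0 j i; have := prob_le1 j i.
  by case: (j == f i) => /=; nra.
rewrite big_split /= p_sum1 (bigD1 (f i)) //= eqxx big1 ?addr0 //.
by move=> j /negPf ->.
Qed.

Definition noise_coef a j f : R := \sum_i a i * noise j i f.

Definition noise_energy a f : R := \sum_j noise_coef a j f ^+ 2.

Lemma noise_energy_ge0 a f : 0 <= noise_energy a f.
Proof. by apply: sumr_ge0 => j _; rewrite sqr_ge0. Qed.

(** Noise at distinct columns is uncorrelated, so only the diagonal of the square
    contributes. *)
Lemma law_mean_noise_energy a :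
  E (noise_energy a) = \sum_i a i ^+ 2 * (1 - \sum_j p j i ^+ 2).
Proof.
rewrite law_mean_sum.
transitivity (\sum_j \sum_i a i ^+ 2 * (p j i - p j i ^+ 2)).
  apply: eq_bigr => j _.
  transitivity (E (fun f => \sum_i \sum_i' (a i * a i') * (noise j i f * noise j i' f))).
    apply: eq_law_mean => f; rewrite expr2 mulr_suml; apply: eq_bigr => i _.
    by rewrite mulr_sumr; apply: eq_bigr => i' _; ring.
  rewrite law_mean_sum; apply: eq_bigr => i _.
  rewrite law_mean_sum (bigD1 i) //= law_meanZ law_mean_noiseM eqxx mul1r.
  rewrite big1 ?addr0 ?expr2 // => i' ii'.
  by rewrite law_meanZ law_mean_noiseM eq_sym (negPf ii') mul0r mulr0.
rewrite exchange_big; apply: eq_bigr => i _ /=.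
by rewrite -mulr_sumr sumrB p_sum1.
Qed.

(** The linear form is centred, and by Cauchy-Schwarz its square is at most
    2 |G|^2, a column of the noise having squared norm at most 2. *)
Lemma law_mean_expR_noise_lin (G : J -> R) i :
  E (fun f => expR (\sum_j G j * noise j i f)) <= expR (4 * \sum_j G j ^+ 2).
Proof.
apply: (@le_trans _ _ (E (fun f => \sum_j G j * noise j i f +
    expR (4 * \sum_j G j ^+ 2)))).
  apply: ler_law_mean => // f; apply: (le_trans (expR_le_addR_expR_sqr _)).
  rewrite lerD2l ler_expR.
  have := cauchy_schwarz_sum G (noise^~ i ^~ f); have := sum_noise_sq_le2 i f.
  have : 0 <= \sum_j G j ^+ 2 by apply: sumr_ge0 => j _; rewrite sqr_ge0.
  nra.
rewrite law_meanD law_mean_cst // law_mean_sum big1 ?add0r // => j _.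
by rewrite law_meanZ law_mean_noise mulr0.
Qed.

(** Integrating out column i, independent of F: the square expands into
    |F|^2, the squared norm of the column, which is at most 2, and a cross term
    linear in the column, whose Laplace transform costs 16 q^2 c^2 |F|^2. *)
Lemma law_mean_expR_add_noise (F : J -> {ffun I -> J} -> R) A i c q :
  (forall j, depends_on A (F j)) -> i \notin A -> 0 <= q ->
  E (fun f => expR (q * \sum_j (c * noise j i f + F j f) ^+ 2)) <=
  expR (2 * q * c ^+ 2) *
    E (fun f => expR (q * (1 + 16 * q * c ^+ 2) * \sum_j F j f ^+ 2)).
Proof.
move=> FA iA q0; rewrite -(law_mean_splice p_sum1 (~: [set i])%SET) -law_meanZ.
apply: ler_law_mean => // f.
have FE j h : F j (splice (~: [set i])%SET f h) = F j f.
  apply: FA => k kA; rewrite ffunE !inE ifT //; apply: contraNneq iA => <- //.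
have NE j h : noise j i (splice (~: [set i])%SET f h) = noise j i h.
  by rewrite /noise ffunE !inE eqxx.
set S := \sum_j F j f ^+ 2.
apply: (@le_trans _ _ (E (fun h => expR (2 * q * c ^+ 2 + q * S) *
    expR (\sum_j (2 * q * c * F j f) * noise j i h)))).
  apply: ler_law_mean => // h; rewrite -expRD ler_expR.
  under eq_bigr do rewrite FE NE.
  have -> : \sum_j (c * noise j i h + F j f) ^+ 2 =
      c ^+ 2 * \sum_j noise j i h ^+ 2 + S + 2 * c * \sum_j F j f * noise j i h.
    by rewrite /S !mulr_sumr -!big_split; apply: eq_bigr => j _ /=; ring.
  have -> : \sum_j (2 * q * c * F j f) * noise j i h =
      2 * q * c * \sum_j F j f * noise j i h.
    by rewrite mulr_sumr; apply: eq_bigr => j _; rewrite mulrA.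
  have : q * c ^+ 2 * \sum_j noise j i h ^+ 2 <= q * c ^+ 2 * 2.
    apply: ler_wpM2l; last exact: sum_noise_sq_le2.
    by rewrite mulr_ge0 // sqr_ge0.
  by move=> ?; lra.
rewrite law_meanZ.
apply: (@le_trans _ _ (expR (2 * q * c ^+ 2 + q * S) *
    expR (4 * \sum_j (2 * q * c * F j f) ^+ 2))).
  by rewrite ler_wpM2l ?expR_ge0 ?law_mean_expR_noise_lin.
rewrite -!expRD ler_expR.
have -> : \sum_j (2 * q * c * F j f) ^+ 2 = (2 * q * c) ^+ 2 * S.
  by rewrite mulr_sumr; apply: eq_bigr => j _; ring.
by rewrite le_eqVlt; apply/orP; left; apply/eqP; ring.
Qed.

(** The coefficient q grows at each integrated column by the factor
    1 + 16 q a_i^2.  The hypothesis on q is preserved because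
    (1 + x) (1 - x) <= 1 with x = 16 q a_i^2; it also keeps q below 1/16, hence
    the rate 1/8 of the accrued cost. *)
Lemma law_mean_expR_noise_seq a s q : uniq s -> 0 <= q ->
  q * (16 + 16 * \sum_(i <- s) a i ^+ 2) <= 1 ->
  E (fun f => expR (q * \sum_j (\sum_(i <- s) a i * noise j i f) ^+ 2)) <=
  expR (8^-1 * \sum_(i <- s) a i ^+ 2).
Proof.
elim: s q => [|i s ih] q /=.
  move=> _ q0 _; rewrite big_nil mulr0 expR0.
  rewrite (@eq_law_mean _ _ _ _ _ (fun=> 1)) ?law_mean_cst // => f.
  by rewrite big1 ?mulr0 ?expR0 // => j _; rewrite big_nil expr0n.
move=> /andP[i_s us] q0; rewrite big_cons => qS.
have S0 : 0 <= \sum_(i <- s) a i ^+ 2 by apply: sumr_ge0 => k _; rewrite sqr_ge0.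
set S := \sum_(i <- s) a i ^+ 2 in qS S0 *.
pose F j f := \sum_(i <- s) a i * noise j i f.
have FA j : depends_on [set k in s]%SET (F j).
  move=> f h fh; apply: eq_big_seq => k ks; congr (_ * _).
  by apply: noise_depends => k'; rewrite inE => /eqP ->; apply: fh; rewrite inE.
have step := @law_mean_expR_add_noise F [set k in s]%SET i (a i) q FA _ q0.
rewrite (@eq_law_mean _ _ _ _ _
  (fun f => expR (q * \sum_j (a i * noise j i f + F j f) ^+ 2))).
  2: by move=> f; congr (expR (_ * _)); apply: eq_bigr => j _; rewrite big_cons.
apply: (le_trans (step _)); first by rewrite inE.
have c0 := sqr_ge0 (a i); set c := a i ^+ 2 in qS c0 *.
apply: (@le_trans _ _ (expR (2 * q * c) * expR (8^-1 * S))).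
  rewrite ler_wpM2l ?expR_ge0 //; apply: ih => //.
    by apply: mulr_ge0 => //; nra.
  have x0 : 0 <= 16 * q * c by nra.
  have h1 : q * (16 + 16 * S) <= 1 - 16 * q * c by lra.
  have : (1 + 16 * q * c) * (q * (16 + 16 * S)) <= (1 + 16 * q * c) * (1 - 16 * q * c).
    by apply: ler_wpM2l => //; lra.
  rewrite -/S; have := sqr_ge0 (16 * q * c); lra.
rewrite -expRD ler_expR.
have q16 : q * 16 <= 1 by nra.
nra.
Qed.

(** For a unit vector the coefficient 1/32 is the largest that
    [law_mean_expR_noise_seq] admits. *)
Lemma law_mean_expR_noise_energy a : \sum_i a i ^+ 2 = 1 ->
  E (fun f => expR (32^-1 * noise_energy a f)) <= 2.
Proof.
move=> a1; apply: (@le_trans _ _ (expR (8^-1 * \sum_i a i ^+ 2))).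
  by apply: law_mean_expR_noise_seq; rewrite ?index_enum_uniq // a1; lra.
rewrite a1 mulr1 -[leRHS]invrK -[expR _]invrK -expRN lef_pV2 ?posrE ?expR_gt0 ?invr_gt0 //.
by have := expR_ge1Dx (- 8^-1 : R); lra.
Qed.

End Noise.

(** * Selection inequality and uniform control of the noise *)

(** Here b, z and h stand for the squared norms of the mean, noise and observed
    coefficients.  Adding twice the criterion inequality reduces the claim to one
    inequality per l, checked in the four cases of membership in m and mh. *)
Lemma selection_deterministic (R : realFieldType) (L : finType) (b z h : L -> R)
    (m mh : {set L}) (P Ph : R) :
  (forall l, 0 <= b l) -> (forall l, 0 <= z l) ->
  (forall l, b l <= 2 * h l + 2 * z l) -> (forall l, h l <= 2 * b l + 2 * z l) ->
  - \sum_(l in mh) h l + Ph <= - \sum_(l in m) h l + P ->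
  \sum_(l | l \notin mh) b l + \sum_(l in mh) z l <=
  5 * \sum_(l | l \notin m) b l + 2 * \sum_(l in m) z l + 2 * P
  + (5 * \sum_(l in mh) z l - 2 * Ph).
Proof.
move=> b0 z0 bhz hbz crit.
have key : \sum_(l | l \notin mh) b l + \sum_(l in mh) z l
    + 2 * \sum_(l in mh) h l <=
    5 * \sum_(l | l \notin m) b l + 2 * \sum_(l in m) z l + 5 * \sum_(l in mh) z l
    + 2 * \sum_(l in m) h l.
  rewrite !mulr_sumr !(big_mkcond (fun l => l \in _)) !(big_mkcond (fun l => l \notin _)).
  rewrite -!big_split; apply: ler_sum => l _ /=.
  have := b0 l; have := z0 l; have := bhz l; have := hbz l.
  by case: (l \in m); case: (l \in mh) => /=; lra.
lra.
Qed.

Section LevelSums.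
Context {R : realType} {I J L K : finType} (p : J -> I -> R).
Hypothesis p_ge0 : forall j i, 0 <= p j i.
Hypothesis p_sum1 : forall i, \sum_j p j i = 1.
Context (phi : L -> I -> R) (lev : L -> K).
Hypothesis phi_unit : forall l, \sum_i phi l i ^+ 2 = 1.
Hypothesis phi_disj : forall l l' i,
  lev l = lev l' -> l != l' -> phi l i * phi l' i = 0.
Implicit Types (f : {ffun I -> J}) (l : L) (m : {set L}).

Local Notation E := (law_mean p).
Local Notation Z l := (noise_energy p (phi l)).
Local Notation n := (#|L|%:R : R).

Definition exp_energy l f : R := expR (64^-1 * Z l f).

Definition exp_energy_dev f : R := \sum_l (exp_energy l f - E (exp_energy l)).

(** The energy along phi_l sees only the columns in the support of phi_l; this is
    what makes energies of one level independent. *)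
Lemma exp_energy_depends l : depends_on [set i | phi l i != 0]%SET (exp_energy l).
Proof.
move=> f h fh; congr (expR (_ * _)); apply: eq_bigr => j _; congr (_ ^+ 2).
apply: eq_bigr => i _; have [->|nz] := eqVneq (phi l i) 0; first by rewrite !mul0r.
rewrite (@noise_depends _ _ _ p j i f h) // => k; rewrite inE => /eqP ->.
by apply: fh; rewrite inE.
Qed.

Lemma law_mean_exp_energy_sq l : E (fun f => exp_energy l f ^+ 2) <= 2.
Proof.
apply: le_trans (law_mean_expR_noise_energy p_ge0 p_sum1 (phi_unit l)).
apply: ler_law_mean => // f; rewrite /exp_energy expr2 -expRD ler_expR; lra.
Qed.

Lemma law_mean_exp_energy l : 0 <= E (exp_energy l) <= 2.
Proof.
apply/andP; split.
  rewrite -(law_mean_cst p_sum1 0); apply: ler_law_mean => // f; exact: expR_ge0.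
apply: le_trans (law_mean_expR_noise_energy p_ge0 p_sum1 (phi_unit l)).
apply: ler_law_mean => // f; rewrite ler_expR.
have := noise_energy_ge0 p (phi l) f; lra.
Qed.

Lemma law_mean_exp_energy_cov l l' : lev l = lev l' ->
  E (fun f => (exp_energy l f - E (exp_energy l)) *
              (exp_energy l' f - E (exp_energy l'))) <= (l == l')%:R * 2.
Proof.
move=> ll'; have [<-|nll'] := eqVneq l l'.
  rewrite mul1r; set e := E (exp_energy l).
  rewrite (@eq_law_mean _ _ _ _ _ (fun f => exp_energy l f ^+ 2 +
     ((- 2 * e) * exp_energy l f + e ^+ 2))); last by move=> f; ring.
  rewrite law_meanD law_meanD law_meanZ law_mean_cst // -/e.
  have := law_mean_exp_energy_sq l; have := sqr_ge0 e; lra.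
rewrite (law_mean_indep p_sum1 (A := [set i | phi l i != 0]%SET)
   (B := [set i | phi l' i != 0]%SET)); last 3 first.
- move=> i; rewrite !inE => nz; rewrite negbK; have /eqP := phi_disj i ll' nll'.
  by rewrite mulf_eq0 (negPf nz).
- by move=> f h fh; congr (_ - _); apply: exp_energy_depends.
- by move=> f h fh; congr (_ - _); apply: exp_energy_depends.
by rewrite law_meanB law_mean_cst // subrr !mul0r.
Qed.

(** Levels are combined by the Cauchy-Schwarz inequality, at the price of the
    factor #|K|; within a level the terms are uncorrelated. *)
Lemma law_mean_exp_energy_dev_sq :
  E (fun f => exp_energy_dev f ^+ 2) <= 2 * #|K|%:R * n.
Proof.
pose Y l f := exp_energy l f - E (exp_energy l).
apply: (@le_trans _ _ (E (fun f => #|K|%:R * \sum_k (\sum_(l | lev l == k) Y l f) ^+ 2))).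
  apply: ler_law_mean => // f.
  have -> : exp_energy_dev f = \sum_k 1 * \sum_(l | lev l == k) Y l f.
    rewrite /exp_energy_dev (partition_big lev xpredT) //.
    by apply: eq_bigr => k _; rewrite mul1r.
  apply: (le_trans (cauchy_schwarz_sum _ _)).
  by rewrite (eq_bigr (fun=> 1)) ?sumr_const // => k _; rewrite expr1n.
rewrite law_meanZ law_mean_sum.
rewrite [leRHS](_ : _ = #|K|%:R * (2 * n)); last by ring.
apply: ler_wpM2l; first exact: ler0n.
have -> : 2 * n = \sum_k \sum_(l | lev l == k) (2 : R).
  transitivity (\sum_(l : L) (2 : R)); first by rewrite sumr_const mulr_natr.
  by rewrite (partition_big lev xpredT).
apply: ler_sum => k _.
rewrite (@eq_law_mean _ _ _ _ _ (fun f => \sum_(l | lev l == k)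
    \sum_(l' | lev l' == k) Y l f * Y l' f)); last first.
  move=> f; rewrite expr2 mulr_suml; apply: eq_bigr => l _.
  by rewrite mulr_sumr.
rewrite law_mean_sum; apply: ler_sum => l /eqP lk.
rewrite law_mean_sum.
apply: (@le_trans _ _ (\sum_(l' | lev l' == k) (l == l')%:R * 2)).
  by apply: ler_sum => l' /eqP l'k; apply: law_mean_exp_energy_cov; rewrite lk.
rewrite (bigD1 l) /= ?lk // eqxx mul1r big1 ?addr0 // => l' /andP[_ nl].
by rewrite eq_sym (negPf nl) mul0r.
Qed.

(** The random part of the bound is the same for all m, so that it also holds for
    a data-dependent m. *)
Lemma sum_energy_le m f : (0 < #|m|)%N ->
  \sum_(l in m) Z l f <=
  64 * #|m|%:R * (ln (n / #|m|%:R) + 3) + 16 * exp_energy_dev f ^+ 2 / n.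
Proof.
move=> m0; set D : R := #|m|%:R; set d := exp_energy_dev f.
have D0 : 0 < D by rewrite ltr0n.
have Dn : D <= n by rewrite ler_nat max_card.
have n0 : 0 < n by apply: lt_le_trans Dn.
have h1 : \sum_(l in m) 64^-1 * Z l f <=
    \sum_(l in m) (D / n * exp_energy l f + ln (n / D)).
  apply: ler_sum => l _; have := @ler_expR_ln _ (64^-1 * Z l f) (n / D).
  by rewrite invf_div => -> //; rewrite divr_gt0.
have h2 : \sum_(l in m) exp_energy l f <= d + 2 * n.
  apply: (@le_trans _ _ (\sum_l exp_energy l f)).
    rewrite [leLHS]big_mkcond; apply: ler_sum => l _.
    by case: ifP => // _; apply: expR_ge0.
  rewrite -subr_ge0 addrAC /d /exp_energy_dev -sumrB.
  rewrite (eq_bigr (fun l => - E (exp_energy l))); last by move=> l _; ring.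
  rewrite sumrN addrC subr_ge0.
  apply: (@le_trans _ _ (\sum_(l : L) (2 : R))).
    by apply: ler_sum => l _; case/andP: (law_mean_exp_energy l).
  by rewrite sumr_const mulr_natr.
(* x <= 1 + x^2 / 4 at x = d / n, using D <= n to drop a factor D / n *)
have h3 : D / n * d <= D + d ^+ 2 / n / 4.
  have t0 : 0 <= D / n <= 1 by rewrite divr_ge0 ?(ltW D0) ?(ltW n0) //= ler_pdivrMr ?mul1r.
  have -> : D = (D / n) * n by rewrite divfK ?gt_eqF.
  rewrite mulfK ?gt_eqF //.
  have -> : d ^+ 2 / n = n * (d / n) ^+ 2 by field; rewrite gt_eqF.
  have -> : D / n * d = D / n * n * (d / n) by field; rewrite gt_eqF.
  set t := D / n in t0 *; set x := d / n.
  have hx : x <= 1 + x ^+ 2 / 4 by have := sqr_ge0 (x - 2); lra.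
  case/andP: t0 => t0 t1.
  have tn : 0 <= t * n by apply: mulr_ge0 => //; rewrite ltW.
  apply: (@le_trans _ _ (t * n * (1 + x ^+ 2 / 4))); first by apply: ler_wpM2l.
  have : t * (n * x ^+ 2) <= 1 * (n * x ^+ 2).
    by apply: ler_wpM2r => //; rewrite mulr_ge0 ?sqr_ge0 ?ltW.
  lra.
have h4 : D / n * \sum_(l in m) exp_energy l f <= D / n * d + 2 * D.
  apply: (@le_trans _ _ (D / n * (d + 2 * n))).
    by apply: ler_wpM2l => //; rewrite divr_ge0 ?ltW.
  by rewrite mulrDr le_eqVlt; apply/orP; left; apply/eqP; field; rewrite gt_eqF.
move: h1; rewrite -mulr_sumr big_split /= -mulr_sumr sumr_const -[ln _ *+ _]mulr_natr -/D => h1.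
lra.
Qed.

End LevelSums.

Section Oracle.
Context {R : realType} {I J L K : finType} (p : J -> I -> R).
Hypothesis p_ge0 : forall j i, 0 <= p j i.
Hypothesis p_sum1 : forall i, \sum_j p j i = 1.
Context (phi : L -> I -> R) (lev : L -> K).
Hypothesis phi_unit : forall l, \sum_i phi l i ^+ 2 = 1.
Hypothesis phi_disj : forall l l' i,
  lev l = lev l' -> l != l' -> phi l i * phi l' i = 0.
Implicit Types (f : {ffun I -> J}) (l : L) (m : {set L}).

Local Notation E := (law_mean p).
Local Notation Z l := (noise_energy p (phi l)).
Local Notation n := (#|L|%:R : R).

Definition mean_energy l : R := \sum_j (\sum_i phi l i * p j i) ^+ 2.

Definition obs_energy l f : R := \sum_j (\sum_i phi l i * (f i == j)%:R) ^+ 2.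

Definition coef_loss m f : R :=
  \sum_(l | l \notin m) mean_energy l + \sum_(l in m) Z l f.

Definition size_pen (c1 c2 : R) m : R :=
  #|m|%:R * (c1 * ln (n / #|m|%:R) + c2).

(** The mean energy is a convex combination of the 1 - |s_i|^2, and
    |s_i|^2 <= max_j s_i^(j) as the entries of s_i sum to 1. *)
Lemma law_mean_energy_bounds (rho : R) l :
  (forall j i, p j i <= 1 - rho) -> rho <= E (Z l) <= 1.
Proof.
move=> prho; rewrite law_mean_noise_energy //; apply/andP; split.
  rewrite -[leLHS]mul1r -{1}(phi_unit l) mulr_suml; apply: ler_sum => i _.
  apply: ler_wpM2l; first exact: sqr_ge0.
  have : \sum_j p j i ^+ 2 <= \sum_j (1 - rho) * p j i.
    by apply: ler_sum => j _; rewrite expr2; apply: ler_wpM2r.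
  by rewrite -mulr_sumr p_sum1; lra.
rewrite -[leRHS](phi_unit l); apply: ler_sum => i _; rewrite -[leRHS]mulr1.
apply: ler_wpM2l; first exact: sqr_ge0.
by rewrite gerBl sumr_ge0 // => j _; rewrite sqr_ge0.
Qed.

Lemma obs_mean_noise l f :
  mean_energy l <= 2 * obs_energy l f + 2 * Z l f /\
  obs_energy l f <= 2 * mean_energy l + 2 * Z l f.
Proof.
have e j : \sum_i phi l i * (f i == j)%:R =
    \sum_i phi l i * p j i + noise_coef p (phi l) j f.
  by rewrite -big_split; apply: eq_bigr => i _; rewrite /noise /=; ring.
rewrite /mean_energy /obs_energy /noise_energy.
under [X in _ <= 2 * X + _]eq_bigr do rewrite e.
under [X in _ /\ X <= _]eq_bigr do rewrite e.
set x := fun j => \sum_i phi l i * p j i; set y := fun j => noise_coef p (phi l) j f.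
rewrite !mulr_sumr -!big_split; split; apply: ler_sum => j _ /=; rewrite -/(x j) -/(y j).
- have := sqr_ge0 (x j + 2 * y j); lra.
- have := sqr_ge0 (x j - y j); lra.
Qed.

Lemma law_mean_coef_loss (rho : R) m : (forall j i, p j i <= 1 - rho) ->
  \sum_(l | l \notin m) mean_energy l + rho * #|m|%:R <= E (coef_loss m).
Proof.
move=> prho; rewrite law_meanD law_mean_cst // lerD2l law_mean_sum.
rewrite mulr_natr -sumr_const; apply: ler_sum => l _.
by case/andP: (law_mean_energy_bounds l prho).
Qed.

(** The factor 5 of the selection inequality times 64 and 3 * 64 in
    [sum_energy_le] gives 320 and 960, which must not exceed 2 c1 and 2 c2. *)
Lemma law_mean_selected_loss (rho c1 c2 : R) (mh : {ffun I -> J} -> {set L}) m :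
  160 <= c1 -> 480 <= c2 -> (forall j i, p j i <= 1 - rho) ->
  (forall f, 0 < #|mh f|)%N -> (0 < #|m|)%N ->
  (forall f, - \sum_(l in mh f) obs_energy l f + size_pen c1 c2 (mh f) <=
             - \sum_(l in m) obs_energy l f + size_pen c1 c2 m) ->
  E (fun f => coef_loss (mh f) f) <=
  5 * \sum_(l | l \notin m) mean_energy l
  + #|m|%:R * (2 + 2 * c1 * ln n + 2 * c2) + 160 * #|K|%:R.
Proof.
move=> hc1 hc2 prho mh0 m0 crit.
have D1 : (1 : R) <= #|m|%:R by rewrite ler1n.
have n1 : (1 : R) <= n by rewrite ler1n (leq_trans m0) // max_card.
apply: (@le_trans _ _ (E (fun f => 5 * \sum_(l | l \notin m) mean_energy l
   + 2 * size_pen c1 c2 m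
   + (2 * \sum_(l in m) Z l f + 80 / n * exp_energy_dev p phi f ^+ 2)))).
  apply: ler_law_mean => // f.
  have sel := @selection_deterministic _ L mean_energy (fun l => Z l f)
    (fun l => obs_energy l f) m (mh f) _ _ _ _ _ _ (crit f).
  apply: le_trans (sel _ _ _ _) _.
  - by move=> l; apply: sumr_ge0 => j _; rewrite sqr_ge0.
  - by move=> l; apply: noise_energy_ge0.
  - by move=> l; case: (obs_mean_noise l f).
  - by move=> l; case: (obs_mean_noise l f).
  have := sum_energy_le p_ge0 p_sum1 phi_unit f (mh0 f).
  rewrite {2}/size_pen.
  have Dh1 : (1 : R) <= #|mh f|%:R by rewrite ler1n.
  have lnh : 0 <= ln (n / #|mh f|%:R).
    by rewrite ln_ge0 // ler_pdivlMr ?mul1r ?ler_nat ?max_card //; lra.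
  set x := ln _ in lnh *; set D : R := #|mh f|%:R in Dh1 *.
  have : 160 * (D * x) <= c1 * (D * x) by apply: ler_wpM2r => //; rewrite mulr_ge0 //; lra.
  have : 480 * D <= c2 * D by apply: ler_wpM2r => //; lra.
  lra.
rewrite !law_meanD !law_mean_cst // !law_meanZ law_mean_sum.
have dev := law_mean_exp_energy_dev_sq p_ge0 p_sum1 phi_unit phi_disj.
have h1 : 80 / n * E (fun f => exp_energy_dev p phi f ^+ 2) <= 160 * #|K|%:R.
  rewrite [leRHS](_ : _ = 80 / n * (2 * #|K|%:R * n)).
    by apply: ler_wpM2l => //; rewrite divr_ge0 //; lra.
  by field; rewrite gt_eqF //; lra.
have h2 : \sum_(l in m) E (Z l) <= #|m|%:R.
  rewrite -[leRHS]mulr1 mulr_natl -sumr_const; apply: ler_sum => l _.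
  by case/andP: (law_mean_energy_bounds l prho).
have h3 : ln (n / #|m|%:R) <= ln n.
  rewrite ler_ln ?posrE ?divr_gt0 ?(lt_le_trans ltr01) //.
  by rewrite ler_pdivrMr ?(lt_le_trans ltr01) // ler_peMr //; lra.
have : #|m|%:R * (c1 * ln (n / #|m|%:R)) <= #|m|%:R * (c1 * ln n).
  by apply: ler_wpM2l; [lra|apply: ler_wpM2l => //; lra].
rewrite /size_pen; lra.
Qed.

End Oracle.

(** * The Haar basis *)

Lemma sum_nat_divn (R : pzRingType) (g : nat -> R) (a M : nat) : (0 < M)%N ->
  \sum_(0 <= i < a * M) g (i %/ M)%N = (\sum_(0 <= q < a) g q) *+ M.
Proof.
move=> M0; elim: a => [|a ih]; first by rewrite mul0n !big_geq // mul0rn.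
rewrite big_nat_recr //= mulrnDl -ih (@big_cat_nat _ _ _ (a * M)) //=; last first.
  by rewrite leq_mul2r leqnSn orbT.
congr (_ + _); rewrite -{1}[(a * M)%N]add0n big_addn mulSn addnK.
rewrite (eq_big_nat _ _ (F2 := fun=> g a)); last first.
  by move=> i /andP[_ iM]; rewrite divnDMl // divn_small.
by rewrite sumr_const_nat subn0.
Qed.

Section Haar.
Context {R : realType}.
Implicit Types (q k M : nat).

Definition haar_step k q : R := (q == k.*2)%:R - (q == k.*2.+1)%:R.

Lemma sum_haar_step (G : nat -> R) (a k : nat) : (k.*2.+1 < a)%N ->
  \sum_(0 <= q < a) G q * haar_step k q = G k.*2 - G k.*2.+1.
Proof.
move=> ka.
have E1 (b : nat) : (b < a)%N -> \sum_(0 <= q < a) G q * (q == b)%:R = G b.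
  move=> ba; rewrite big_mkord (bigD1 (Ordinal ba)) //= eqxx mulr1 big1 ?addr0 //.
  by move=> i; rewrite -val_eqE /= => /negPf ->; rewrite mulr0.
rewrite -(E1 k.*2) ?(ltnW ka) // -(E1 k.*2.+1) // -sumrB.
by apply: eq_bigr => q _; rewrite mulrBr.
Qed.

(** With i counted from 0, the dyadic conditions on (i + 1) / n say in which
    block of length 2^(N - j - 1) the integer i lies. *)
Lemma haar_motherE (N j k i : nat) : (j < N)%N ->
  haar_mother (2 ^+ j * (i.+1%:R / (2 ^ N)%N%:R) - k%:R : R) =
  haar_step k (i %/ 2 ^ (N - j.+1)).
Proof.
move=> jN; set M := (2 ^ (N - j.+1))%N.
have M0 : (0 < M)%N by rewrite expn_gt0.
have MR0 : 0 < (2 * M%:R : R) by rewrite mulr_gt0 // ltr0n.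
have -> : 2 ^+ j * (i.+1%:R / (2 ^ N)%N%:R) - k%:R =
    (i.+1%:R - (k.*2 * M)%N%:R) / (2 * M%:R) :> R.
  have -> : (2 ^ N = 2 ^ j * (2 * M))%N.
    by rewrite -[(2 * M)%N]expnS -expnD; congr (_ ^ _)%N; lia.
  rewrite -muln2 !natrM natrX; field.
  by rewrite expf_neq0 ?pnatr_eq0 -?lt0n ?M0.
set x := _ / _.
have c1 : (0 < x) = (k.*2 <= i %/ M)%N.
  by rewrite ltr_pdivlMr // mul0r subr_gt0 ltr_nat ltnS leq_divRL.
have c2 : (x <= 1 / 2) = (i %/ M < k.*2.+1)%N.
  rewrite ler_pdivrMr // mulrA mulfVK ?pnatr_eq0 // mul1r lerBlDr -natrD ler_nat.
  by rewrite ltn_divLR // mulSn.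
have c3 : (x <= 1) = (i %/ M < k.*2.+2)%N.
  rewrite ler_pdivrMr // mul1r lerBlDr -natrM -natrD ler_nat.
  by rewrite ltn_divLR // !mulSn mul0n addn0 addnA.
rewrite /haar_mother /haar_step c1 c2 c3 ltNge c2; set q := (i %/ M)%N.
have [->|q1] := eqVneq q k.*2.
  by rewrite leqnn ltnSn /= ltn_eqF // subr0.
have [->|q2] := eqVneq q k.*2.+1.
  by rewrite ltnn andbF /= ltnSn sub0r.
rewrite subrr ifF; last by lia.
by rewrite ifF //; lia.
Qed.

Local Notation c N j := (2 `^ ((j : nat)%:R / 2) / Num.sqrt (2 ^ N)%N%:R : R).

Lemma haar_vector_None N i :
  haar_vector R (None : haar_index N) 0 i = 1 / Num.sqrt (2 ^ N)%N%:R.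
Proof. by rewrite mxE. Qed.

Lemma haar_vector_Some N (j : 'I_N) (k : 'I_(2 ^ j)) i :
  haar_vector R (Some (existT (fun j : 'I_N => 'I_(2 ^ j)) j k)) 0 i =
  c N j * haar_step k (i %/ 2 ^ (N - j.+1)).
Proof. by rewrite mxE haar_motherE. Qed.

Lemma haar_const_sq N (j : 'I_N) : c N j ^+ 2 = (2 ^ (N - j.+1) * 2)%N%:R^-1.
Proof.
rewrite expr_div_n sqr_sqrtr ?ler0n // -powR_mulrn ?powR_ge0 // -powRrM.
rewrite divfK ?pnatr_eq0 // powR_mulrn ?ler0n //.
have -> : (2 ^ N = 2 ^ j * (2 ^ (N - j.+1) * 2))%N.
  by rewrite -expnSr -expnD; congr (_ ^ _)%N; have := ltn_ord j; lia.
rewrite [(2 ^ j * _)%N%:R]natrM natrX invfM mulrA mulfV ?mul1r //.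
Qed.

Definition haar_level N (l : haar_index N) : option 'I_N :=
  if l is Some (existT j _) then Some j else None.

Lemma haar_disjoint N (l l' : haar_index N) i :
  haar_level l = haar_level l' -> l != l' ->
  haar_vector R l 0 i * haar_vector R l' 0 i = 0.
Proof.
case: l l' => [[j k]|] [[j' k']|] //= [] jj'; move: k'; rewrite -{}jj' => k' ll'.
have kk' : k != k' by apply: contraNneq ll' => ->.
rewrite !haar_vector_Some mulrACA; set q := (_ %/ _)%N.
rewrite (_ : haar_step k q * haar_step k' q = 0) ?mulr0 // /haar_step.
have {}kk' : nat_of_ord k != k' by [].
have [->|] := eqVneq q k.*2.
  rewrite (_ : k.*2 == k'.*2 = false) 1?(_ : k.*2 == k'.*2.+1 = false)
    ?subrr ?mulr0 //; lia.
have [->|] := eqVneq q k.*2.+1; last by rewrite subrr mul0r.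
rewrite (_ : k.*2.+1 == k'.*2 = false) 1?(_ : k.*2.+1 == k'.*2.+1 = false)
  ?subrr ?mulr0 //; lia.
Qed.

(** Summing over blocks: inner products against a Haar vector only compare the
    two halves of its support.  Norms and orthogonality across levels follow. *)
Lemma sum_haar_vector N (G : nat -> R) (j : 'I_N) (k : 'I_(2 ^ j)) :
  \sum_(i < 2 ^ N) G (i %/ 2 ^ (N - j.+1))%N *
     haar_vector R (Some (existT (fun j : 'I_N => 'I_(2 ^ j)) j k)) 0 i =
  c N j * (G k.*2 - G k.*2.+1) *+ 2 ^ (N - j.+1).
Proof.
under eq_bigr do rewrite haar_vector_Some mulrCA.
rewrite -mulr_sumr -mulrnAr; congr (_ * _).
set M := (2 ^ (N - j.+1))%N.
have nE : (2 ^ N = 2 ^ j.+1 * M)%N.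
  by rewrite -expnD; congr (_ ^ _)%N; have := ltn_ord j; lia.
rewrite -(@sum_haar_step G (2 ^ j.+1)) -?sum_nat_divn ?expn_gt0 // -?nE ?big_mkord //.
by have := ltn_ord k; rewrite expnS; lia.
Qed.

Lemma haar_unit N (l : haar_index N) :
  \sum_(i < 2 ^ N) haar_vector R l 0 i ^+ 2 = 1.
Proof.
case: l => [[j k]|]; last first.
  under eq_bigr do rewrite haar_vector_None.
  rewrite sumr_const card_ord expr_div_n expr1n sqr_sqrtr ?ler0n //.
  by rewrite mul1r -[_ *+ _]mulr_natr mulVf // pnatr_eq0 expn_eq0.
have := @sum_haar_vector N (fun q => c N j * haar_step k q) j k.
under eq_bigr do rewrite -haar_vector_Some -expr2.
move=> ->; rewrite -mulrBr mulrA -expr2 haar_const_sq /haar_step !eqxx.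
rewrite eqn_leq ltnn andbF [k.*2.+1 == _]gtn_eqF // subr0 sub0r opprK.
rewrite -mulr_natr -mulrA -[1 + 1]/(2%:R) -natrM mulnC mulVf //.
Qed.

(** Within a level the supports are disjoint; across levels the coarser vector is
    constant on the support of the finer one, whose entries sum to 0. *)
Lemma haar_orthogonal N (l l' : haar_index N) : l != l' ->
  \sum_(i < 2 ^ N) haar_vector R l 0 i * haar_vector R l' 0 i = 0.
Proof.
pose le_lev (l1 l2 : haar_index N) : bool :=
  if haar_level l1 is Some j1 then
    if haar_level l2 is Some j2 then (j1 <= j2)%N else false
  else true.
wlog : l l' / le_lev l l'.
  move=> H ll'; case: (boolP (le_lev l l')) => [h|]; first exact: H.
  move=> h; under eq_bigr do rewrite mulrC; apply: H; last by rewrite eq_sym.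
  move: h; rewrite /le_lev; case: (haar_level l) => [j|] //.
  by case: (haar_level l') => // j'; rewrite -ltnNge => /ltnW.
move=> h ll'.
have [ee|nee] := eqVneq (haar_level l) (haar_level l').
  by rewrite big1 // => i _; apply: haar_disjoint.
case: l l' ll' h nee => [[j k]|] [[j' k']|] //= _ jj' nee.
  have {}jj' : (j < j')%N.
    rewrite ltn_neqAle; move: jj'; rewrite /le_lev /= => ->; rewrite andbT.
    by apply: contraNneq nee => /val_inj ->.
  pose D := (2 ^ (j' - j.+1))%N.
  have ME : (2 ^ (N - j.+1) = 2 ^ (N - j'.+1) * (2 * D))%N.
    by rewrite -expnS -expnD; congr (_ ^ _)%N; have := ltn_ord j'; lia.
  pose G q : R := c N j * haar_step k (q %/ (2 * D)).
  transitivity (\sum_(i < 2 ^ N) G (i %/ 2 ^ (N - j'.+1))%N *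
      haar_vector R (Some (existT (fun j : 'I_N => 'I_(2 ^ j)) j' k')) 0 i).
    by apply: eq_bigr => i _; rewrite [X in X * _]haar_vector_Some ME divnMA.
  rewrite sum_haar_vector /G !divnMA !divn2 doubleK.
  by rewrite -[k'.*2.+1./2]/(uphalf k'.*2) uphalf_double subrr mulr0 mul0rn.
rewrite -[RHS](_ : c N j' * (1 / Num.sqrt (2 ^ N)%N%:R - 1 / Num.sqrt (2 ^ N)%N%:R)
    *+ 2 ^ (N - j'.+1) = 0); last by rewrite subrr mulr0 mul0rn.
rewrite -(@sum_haar_vector N (fun=> 1 / Num.sqrt (2 ^ N)%N%:R) j' k').
by apply: eq_bigr => i _; rewrite [X in X * _]haar_vector_None.
Qed.

Lemma card_haar_index N : #|haar_index N| = (2 ^ N)%N.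
Proof.
rewrite card_option card_tagged sumnE big_map big_enum /=.
under eq_bigr do rewrite card_ord.
rewrite -(big_mkord xpredT (fun j => 2 ^ j)%N).
elim: N => [|N ih]; first by rewrite big_geq.
by rewrite big_nat_recr //= -addSn ih expnS mul2n addnn.
Qed.

End Haar.

(** * Projections in an orthonormal basis *)

Section Orthonormal.
Context {R : realType} {L : finType} {r n : nat} (phi : L -> 'rV[R]_n).
Hypothesis phi_unit : forall l, \sum_i phi l 0 i ^+ 2 = 1.
Hypothesis phi_orth : forall l l', l != l' -> \sum_i phi l 0 i * phi l' 0 i = 0.
Hypothesis card_L : #|L| = n.
Implicit Types (l : L) (m : {set L}) (j : 'I_r) (t u x s : 'M[R]_(r, n)).

Lemma phi_dot l l' : \sum_i phi l 0 i * phi l' 0 i = (l == l')%:R.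
Proof.
have [<-|/phi_orth//] := eqVneq l l'.
by rewrite -(phi_unit l); apply: eq_bigr => i _; rewrite expr2.
Qed.

Lemma span_orthogonal (w v : 'rV[R]_n) (X : seq 'rV[R]_n) :
  {in X, forall u : 'rV[R]_n, \sum_i u 0 i * w 0 i = 0} -> v \in <<X>>%VS ->
  \sum_i v 0 i * w 0 i = 0.
Proof.
move=> Xw.
have dotE (u : 'rV[R]_n) : \sum_i u 0 i * w 0 i = (u *m w^T) 0 0.
  by rewrite mxE; apply: eq_bigr => i _; rewrite mxE.
pose h : 'Hom('rV[R]_n, 'M[R]_1) := linfun (mulmxr w^T).
have : (<<X>> <= lker h)%VS.
  apply/span_subvP => u uX; rewrite memv_ker lfunE /=; apply/eqP/matrixP => a b.
  by rewrite !ord1 -dotE Xw // mxE.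
move=> /subvP sub /sub; rewrite memv_ker lfunE /= => /eqP hv.
by rewrite dotE hv mxE.
Qed.

(** A new vector in the span of the previous ones would be orthogonal to itself. *)
Lemma free_orthonormal (S : seq L) : uniq S -> free (map phi S).
Proof.
elim: S => [|l S ih] /=; first by rewrite nil_free.
case/andP => lS uS; rewrite free_cons ih // andbT.
apply/negP => /(span_orthogonal (w := phi l)) H.
have := phi_dot l l; rewrite eqxx H; first by move/eqP; rewrite eq_sym oner_eq0.
by move=> _ /mapP[l' l'S ->]; apply: phi_orth; apply: contraNneq lS => <-.
Qed.

Lemma dim_span_orthonormal m : \dim <<[seq phi l | l in m]>> = #|m|.
Proof.
have := free_orthonormal (enum_uniq (mem m)); rewrite /free => /eqP ->.
by rewrite size_map cardE.
Qed.

(** The square matrix of the family has its transpose as right inverse, hence also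
    as left inverse. *)
Lemma orthonormal_complete i i' : \sum_l phi l 0 i * phi l 0 i' = (i == i')%:R.
Proof.
clear r; move: phi phi_dot i i'; case: n / card_L => psi psi_dot i i'.
pose A : 'M[R]_#|L| := \matrix_(a, k) psi (enum_val a) 0 k.
have : A *m A^T = 1%:M.
  apply/matrixP => a b; rewrite !mxE -(inj_eq enum_val_inj) -psi_dot.
  by apply: eq_bigr => k _; rewrite !mxE.
move/mulmx1C/matrixP/(_ i i'); rewrite !mxE => <-.
rewrite (reindex _ (onW_bij _ (enum_val_bij L))) /=.
by apply: eq_bigr => a _; rewrite !mxE.
Qed.

Lemma parseval (a b : 'I_n -> R) :
  \sum_l (\sum_i phi l 0 i * a i) * (\sum_i phi l 0 i * b i) = \sum_i a i * b i.
Proof.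
transitivity (\sum_i \sum_i' a i * b i' * \sum_l phi l 0 i * phi l 0 i').
  under [RHS]eq_bigr do under eq_bigr do rewrite mulr_sumr.
  under [RHS]eq_bigr do rewrite exchange_big.
  rewrite [RHS]exchange_big; apply: eq_bigr => l _ /=.
  rewrite mulr_suml; apply: eq_bigr => i _.
  by rewrite mulr_sumr; apply: eq_bigr => i' _; ring.
apply: eq_bigr => i _; rewrite (bigD1 i) //= orthonormal_complete eqxx mulr1.
rewrite big1 ?addr0 // => i' ii'.
by rewrite orthonormal_complete eq_sym (negPf ii') mulr0.
Qed.

Definition coef t l j : R := \sum_i phi l 0 i * t j i.

Lemma minner_coef t u : minner t u = \sum_l \sum_j coef t l j * coef u l j.
Proof.
by rewrite exchange_big; apply: eq_bigr => j _; rewrite -parseval.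
Qed.

Lemma minner_ge0 t : 0 <= minner t t.
Proof. by do 2![apply: sumr_ge0 => ? _]; rewrite -expr2 sqr_ge0. Qed.

Lemma minner_eq0 t : minner t t = 0 -> t = 0.
Proof.
move=> t0; apply/matrixP => j i; rewrite mxE; apply/eqP; rewrite -sqrf_eq0.
move/eqP: t0; rewrite psumr_eq0; last first.
  by move=> ? _; apply: sumr_ge0 => ? _; rewrite -expr2 sqr_ge0.
move=> /allP/(_ j (mem_index_enum _)) /=; rewrite psumr_eq0; last first.
  by move=> ? _; rewrite -expr2 sqr_ge0.
by move=> /allP/(_ i (mem_index_enum _)) /=; rewrite expr2.
Qed.

Lemma coefB t u l j : coef (t - u) l j = coef t l j - coef u l j.
Proof. by rewrite -sumrB; apply: eq_bigr => i _; rewrite !mxE mulrBr. Qed.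

Definition expansion m x : 'M[R]_(r, n) :=
  \matrix_(j, i) \sum_(l in m) coef x l j * phi l 0 i.

Lemma coef_expansion m x l j :
  coef (expansion m x) l j = if l \in m then coef x l j else 0.
Proof.
transitivity (\sum_(l' in m) coef x l' j * (l == l')%:R).
  under eq_bigr do rewrite -phi_dot mulr_sumr.
  rewrite exchange_big; apply: eq_bigr => i _; rewrite mxE mulr_sumr.
  by apply: eq_bigr => l' _; ring.
case: ifP => lm; last first.
  rewrite big1 // => l' l'm; rewrite (_ : l == l' = false) ?mulr0 //.
  by apply: contraFF lm => /eqP ->.
rewrite (bigD1 l) //= eqxx mulr1 big1 ?addr0 // => l' /andP[_ ll'].
by rewrite eq_sym (negPf ll') mulr0.
Qed.

Lemma orth_proj_expansion m x :
  orth_proj (tensor_space <<[seq phi l | l in m]>>%VS) x = expansion m x.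
Proof.
set V := <<_>>%VS.
have Vexp : tensor_space V (expansion m x).
  move=> j; rewrite (_ : row j _ = \sum_(l in m) coef x l j *: phi l).
    by apply: memv_suml => l lm; apply: memvZ; apply: memv_span; apply: fintype.image_f.
  apply/matrixP => a i; rewrite !mxE summxE; apply: eq_bigr => l _.
  by rewrite mxE ord1.
have Oexp t : tensor_space V t -> minner (x - expansion m x) t = 0.
  move=> Vt; rewrite /minner big1 // => j _.
  rewrite -[RHS](@span_orthogonal (row j (x - expansion m x)) (row j t) _ _ (Vt j)).
    by apply: eq_bigr => i _; rewrite !mxE mulrC.
  move=> _ /fintype.imageP[l lm ->].
  rewrite -[RHS](subrr (coef x l j)).
  rewrite -[in X in _ = _ - X](_ : coef (expansion m x) l j = coef x l j).
    by rewrite -coefB; apply: eq_bigr => i _; rewrite mxE.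
  by rewrite coef_expansion lm.
apply: xget_unique; first by split.
move=> q [Vq Oq]; apply/eqP; rewrite -subr_eq0; apply/eqP/minner_eq0.
have minnerBl a b u : minner (a - b) u = minner a u - minner b u.
  rewrite /minner -sumrB; apply: eq_bigr => j _; rewrite -sumrB.
  by apply: eq_bigr => i _; rewrite !mxE mulrBl.
have Vd : tensor_space V (q - expansion m x).
  by move=> j; rewrite linearB /=; apply: rpredB; [exact: Vq|exact: Vexp].
rewrite [X in minner X _ = _](_ : _ = (x - expansion m x) - (x - q)).
  by rewrite minnerBl Oexp // Oq // subrr.
by apply/matrixP => a b; rewrite !mxE; ring.
Qed.

Lemma mnorm_sq t : mnorm t ^+ 2 = \sum_l \sum_j coef t l j ^+ 2.
Proof.
rewrite /mnorm sqr_sqrtr ?minner_ge0 // minner_coef.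
by apply: eq_bigr => l _; apply: eq_bigr => j _; rewrite expr2.
Qed.

Lemma mnorm_sub_expansion_sq s m x :
  mnorm (s - expansion m x) ^+ 2 =
  \sum_(l | l \notin m) \sum_j coef s l j ^+ 2 +
  \sum_(l in m) \sum_j (coef x l j - coef s l j) ^+ 2.
Proof.
rewrite mnorm_sq (bigID (fun l => l \in m)) /= addrC; congr (_ + _);
  apply: eq_bigr => l lm; apply: eq_bigr => j _; rewrite coefB coef_expansion.
- by rewrite (negPf lm) subr0.
- by rewrite lm; ring.
Qed.

Lemma gamma_n_expansion m x :
  gamma_n x (expansion m x) = - \sum_(l in m) \sum_j coef x l j ^+ 2.
Proof.
rewrite /gamma_n mnorm_sq minner_coef mulr_sumr -sumrB -sumrN [RHS]big_mkcond /=.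
apply: eq_bigr => l _; rewrite mulr_sumr -sumrB; case: ifP => lm.
  by rewrite -sumrN; apply: eq_bigr => j _; rewrite coef_expansion lm; ring.
by rewrite big1 // => j _; rewrite coef_expansion lm; ring.
Qed.

Definition onehot (f : {ffun 'I_n -> 'I_r}) : 'M[R]_(r, n) :=
  \matrix_(j, i) (f i == j)%:R.

Lemma mnorm_sub_expansion_onehot s m f :
  mnorm (s - expansion m (onehot f)) ^+ 2 =
  coef_loss (fun j i => s j i) (fun l i => phi l 0 i) m f.
Proof.
rewrite mnorm_sub_expansion_sq; congr (_ + _); apply: eq_bigr => l _.
apply: eq_bigr => j _; congr (_ ^+ 2); rewrite -sumrB.
by apply: eq_bigr => i _; rewrite mxE -mulrBr.
Qed.

Lemma gamma_n_onehot m f :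
  gamma_n (onehot f) (expansion m (onehot f)) =
  - \sum_(l in m) obs_energy (fun l i => phi l 0 i) l f.
Proof.
rewrite gamma_n_expansion; congr (- _); apply: eq_bigr => l _.
apply: eq_bigr => j _; congr (_ ^+ 2).
by apply: eq_bigr => i _; rewrite mxE.
Qed.

End Orthonormal.

(** * Categorical samples as a finite product law *)

Section CategoricalSample.
Context {d : measure_display} {T : measurableType d} {R : realType}
  (P : probability T R) {r n : nat} (X : 'I_r -> 'I_n -> {RV P >-> R})
  (s : 'M[R]_(r, n)).
Hypothesis Xs : categorical_sample X s.
Implicit Types (f : {ffun 'I_n -> 'I_r}) (w : T).

Definition hit j i : set T := X j i @^-1` [set 1].

Lemma measurable_hit j i : measurable (hit j i).
Proof. exact: measurable_funPTI. Qed.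

Lemma sample_indic j i w : X j i w = \1_(hit j i) w.
Proof.
case: Xs => X01 _ _ _; rewrite indicE /hit; case: (X01 w j i) => Xw.
  by rewrite memNset //= => h; move: Xw; rewrite h => /eqP; rewrite oner_eq0.
by rewrite mem_set.
Qed.

Lemma prob_hit j i : P (hit j i) = (s j i)%:E.
Proof.
case: Xs => _ _ _ <-; rewrite -expectation_indic; last exact: measurable_hit.
by rewrite unlock; apply: eq_integral => w _; rewrite sample_indic.
Qed.

Lemma sample_mean_ge0 j i : 0 <= s j i.
Proof. by rewrite -lee_fin -prob_hit. Qed.

Lemma sample_mean_sum1 i : \sum_j s j i = 1.
Proof.
case: Xs => _ X1 _ XE; apply: EFin_inj; rewrite -sumEFin.
under eq_bigr do rewrite -XE unlock.
rewrite -ge0_integral_sum //=.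
- transitivity (\int[P]_(w in setT) (cst 1%:E w))%E.
    by apply: eq_integral => w _; rewrite sumEFin X1.
  by rewrite integral_cst //= probability_setT mule1.
- by move=> j; apply/measurable_EFinP; apply: measurable_funP.
- by move=> j w _; rewrite lee_fin sample_indic indicE ler0n.
Qed.

Definition outcome f : set T := \bigcap_(i in [set` [set: 'I_n]%SET]) hit (f i) i.

Lemma measurable_outcome f : measurable (outcome f).
Proof.
by apply: fin_bigcap_measurable => [|i _]; [exact: finite_finset|exact: measurable_hit].
Qed.

(** The event that a column takes a given value belongs to the sigma-algebra of that
    column, so mutual independence applies. *)
Lemma prob_outcome f : P (outcome f) = (law_weight (fun j i => s j i) f)%:E.
Proof.
case: Xs => _ _ indep _; rewrite /outcome indep => [|i _].
  rewrite -prodEFin; apply: eq_big => [i|i _]; first by rewrite inE.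
  exact: prob_hit.
apply: sub_sigma_algebra; rewrite (bigD1 (f i)) //=; left.
by exists [set 1]; rewrite ?setTI.
Qed.

Lemma random_mx_onehot w : exists f, random_mx X w = onehot f.
Proof.
case: Xs => X01 X1 _ _.
have ex i : exists j, X j i w == 1.
  have [j Xj|H] := pickP (fun j => X j i w == 1); first by exists j.
  have := X1 w i; rewrite big1 => [/eqP|j _]; first by rewrite eq_sym oner_eq0.
  by case: (X01 w j i) => // /eqP Xj; move: (H j); rewrite Xj.
exists [ffun i => xchoose (ex i)]; apply/matrixP => j i; rewrite !mxE ffunE.
have /eqP e1 := xchooseP (ex i); set j0 := xchoose (ex i) in e1 *.
have [<-//|jj0] := eqVneq j0 j.
have : \sum_(j' | j' != j0) X j' i w = 0.
  by have := X1 w i; rewrite (bigD1 j0) //= e1; lra.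
move/eqP; rewrite psumr_eq0 => [|j' _]; last by rewrite sample_indic indicE ler0n.
by move=> /allP/(_ j (mem_index_enum _)); rewrite eq_sym jj0 => /eqP.
Qed.

Lemma outcomeE f w : outcome f w <-> random_mx X w = onehot f.
Proof.
split=> [fw|H i _]; last first.
  by rewrite /hit /=; have /matrixP/(_ (f i) i) := H; rewrite !mxE eqxx.
have [g gw] := random_mx_onehot w.
suff -> : f = g by [].
apply/ffunP => i; have /matrixP/(_ (f i) i) := gw; rewrite !mxE.
have -> : X (f i) i w = 1 by apply: (fw i); rewrite /= inE.
by case: eqP => [->//|_ /eqP]; rewrite oner_eq0.
Qed.

Lemma onehot_inj f g : onehot f = onehot g :> 'M[R]_(r, n) -> f = g.
Proof.
move=> fg; apply/ffunP => i; have /matrixP/(_ (f i) i) := fg; rewrite !mxE eqxx.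
by case: eqP => [->//|_ /eqP]; rewrite oner_eq0.
Qed.

(** A function of the sample is a finite combination of indicators of outcomes,
    which also settles measurability. *)
Lemma expectation_sample (h : 'M[R]_(r, n) -> R) : (forall x, 0 <= h x) ->
  ('E_P[fun w => h (random_mx X w)])%E =
  (law_mean (fun j i => s j i) (fun f => h (onehot f)))%:E.
Proof.
move=> h0; rewrite unlock.
have E w : (h (random_mx X w))%:E =
    (\sum_f (h (onehot f))%:E * (\1_(outcome f) w)%:E)%E.
  have [f0 f0w] := random_mx_onehot w.
  rewrite (bigD1 f0) //= big1 => [|f ff0].
    by rewrite indicE mem_set ?mule1 ?adde0 ?f0w //; apply/outcomeE.
  rewrite indicE memNset ?mule0 // => /outcomeE; rewrite f0w => /onehot_inj e.
  by rewrite e eqxx in ff0.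
under eq_integral do rewrite E.
rewrite ge0_integral_sum //=; last 2 first.
- move=> f; apply: measurable_funeM; apply/measurable_EFinP.
  exact/measurable_indic/measurable_outcome.
- by move=> f w _; rewrite mule_ge0 // lee_fin // indicE ler0n.
rewrite /law_mean -sumEFin; apply: eq_bigr => f _.
rewrite ge0_integralZl_EFin //=; last first.
  by apply/measurable_EFinP/measurable_indic/measurable_outcome.
rewrite integral_indic //; last exact: measurable_outcome.
by rewrite setIT EFinM muleC; congr (_ * _)%E; apply: prob_outcome.
Qed.

End CategoricalSample.

(** * The oracle inequality *)

Section EHRisk.
Context {R : realType} {N r : nat} {d : measure_display} {T : measurableType d}
  (P : probability T R) (X : 'I_r -> 'I_(2 ^ N) -> {RV P >-> R})
  (s : 'M[R]_(r, 2 ^ N)).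
Hypothesis Xs : categorical_sample X s.

Local Notation p := (fun j i => s j i).
Local Notation phi := (fun l i => haar_vector R l 0 i).
Local Notation bias m := (\sum_(l | l \notin val m) mean_energy p phi l).
Implicit Types m : eh_model N.

Lemma shat_haar m (x : 'M[R]_(r, 2 ^ N)) :
  shat (@eh_space R N) m x = expansion (@haar_vector R N) (val m) x.
Proof.
exact: (orth_proj_expansion (@haar_unit R N) (@haar_orthogonal R N)).
Qed.

Lemma eh_penE (c1 c2 : R) m : eh_pen c1 c2 m = size_pen c1 c2 (val m).
Proof.
rewrite /eh_pen /size_pen /eh_space.
by rewrite (dim_span_orthonormal (@haar_unit R N) (@haar_orthogonal R N)) card_haar_index.
Qed.

Lemma risk_haar (mhat : 'M[R]_(r, 2 ^ N) -> eh_model N) :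
  risk X s (penalized_estimator (@eh_space R N) mhat) =
  (law_mean p (fun f => coef_loss p phi (val (mhat (onehot f))) f))%:E.
Proof.
pose h (x : 'M[R]_(r, 2 ^ N)) :=
  mnorm (s - penalized_estimator (@eh_space R N) mhat x) ^+ 2.
rewrite [LHS](expectation_sample Xs (h := h)) => [|x]; last exact: sqr_ge0.
congr (_%:E); apply: eq_law_mean => f.
rewrite /h /penalized_estimator shat_haar.
exact: (mnorm_sub_expansion_onehot (@haar_unit R N) (@haar_orthogonal R N) (card_haar_index N)).
Qed.

Lemma card_eh_model m : (0 < #|val m|)%N.
Proof. by apply/card_gt0P; exists None; apply: (valP m). Qed.

(** B and D are the squared bias and the dimension of the model m. *)
Lemma risk_oracle (rho c1 c2 : R) (mhat : 'M[R]_(r, 2 ^ N) -> eh_model N) m :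
  160 <= c1 -> 480 <= c2 -> (forall j i, s j i <= 1 - rho) ->
  penalized_selector (@eh_space R N) (@eh_pen R N c1 c2) mhat ->
  exists B D : R, [/\ 0 <= B, 1 <= D,
   ((B + rho * D)%:E <= risk X s (shat (@eh_space R N) m))%E &
   (risk X s (penalized_estimator (@eh_space R N) mhat) <=
   (5 * B + D * (2 + 2 * c1 * ln (2 ^ N)%N%:R + 2 * c2) + 160 * N.+1%:R)%:E)%E].
Proof.
move=> hc1 hc2 srho sel; exists (bias m), #|val m|%:R; split.
- by apply: sumr_ge0 => l _; apply: sumr_ge0 => j _; rewrite sqr_ge0.
- by rewrite ler1n card_eh_model.
- have -> : shat (@eh_space R N) m = penalized_estimator (@eh_space R N) (fun=> m) by [].
  rewrite risk_haar lee_fin.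
  exact: (law_mean_coef_loss (sample_mean_ge0 Xs) (sample_mean_sum1 Xs) (@haar_unit R N)).
rewrite risk_haar lee_fin.
have := @law_mean_selected_loss R _ _ _ _ p (sample_mean_ge0 Xs) (sample_mean_sum1 Xs)
  phi (@haar_level N) (@haar_unit R N) (@haar_disjoint R N) rho c1 c2
  (fun f => val (mhat (onehot f))) (val m) hc1 hc2 srho.
rewrite card_haar_index card_option card_ord; apply.
- by move=> f; apply: card_eh_model.
- exact: card_eh_model.
move=> f; have := sel (onehot f) m; rewrite !shat_haar !eh_penE.
by rewrite !(gamma_n_onehot (@haar_unit R N) (@haar_orthogonal R N) (card_haar_index N)).
Qed.

End EHRisk.

Theorem proposition2 (R : realType) :
  exists kappa1 kappa2 : R, 0 < kappa1 /\ 0 < kappa2 /\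
  forall c1 c2 rho : R, kappa1 <= c1 -> kappa2 <= c2 -> 0 < rho ->
  exists C : R, 0 < C /\
  forall (N r : nat), (1 <= N)%N -> (2 <= r)%N ->
  forall (d : measure_display) (T : measurableType d) (P : probability T R)
    (X : 'I_r -> 'I_(2 ^ N) -> {RV P >-> R}) (s : 'M[R]_(r, 2 ^ N)),
  categorical_sample X s ->
  (forall (j : 'I_r) (i : 'I_(2 ^ N)), s j i <= 1 - rho) ->
  forall mhat : 'M[R]_(r, 2 ^ N) -> eh_model N,
  penalized_selector (@eh_space R N) (@eh_pen R N c1 c2) mhat ->
  (risk X s (penalized_estimator (@eh_space R N) mhat)
   <= (C * ln ((2 ^ N)%N%:R))%:E
      * ereal_inf [set risk X s (shat (@eh_space R N) m) | m in [set: eh_model N]])%E.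
Proof.
exists 160, 480; split; first by []; split; first by [].
move=> c1 c2 rho hc1 hc2 rho0.
have ln2 : 0 < ln (2 : R) by rewrite ln_gt0 // ltr1n.
(* Since N ln 2 = ln n and D >= 1, the terms of the risk bound that do not carry
   the bias, including 160 (N + 1) <= 320 N, are at most K (ln n) D. *)
pose K : R := (2 + 2 * c2 + 320) / ln 2 + 2 * c1.
have K0 : 0 <= K.
  by rewrite addr_ge0 ?divr_ge0 ?(ltW ln2) //; lra.
exists (5 / ln 2 + K / rho); split.
  by rewrite ltr_pwDl ?divr_gt0 ?divr_ge0 ?(ltW rho0).
move=> N r N1 _ d T P X s Xs srho mhat sel.
have lnE : ln (2 ^ N)%N%:R = N%:R * ln 2 :> R.
  by rewrite natrX lnXn ?mulr_natl.
set L : R := ln _ in lnE *.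
have NR : (1 : R) <= N%:R by rewrite ler1n.
have CL : 0 < (5 / ln 2 + K / rho) * L.
  rewrite mulr_gt0 ?lnE ?mulr_gt0 //; last by lra.
  by rewrite ltr_pwDl ?divr_gt0 ?divr_ge0 ?(ltW rho0).
rewrite -lee_pdivrMl //; apply/ereal_infP => _ [m _ <-].
rewrite lee_pdivrMl //.
have [B [D [B0 D1 lo up]]] := risk_oracle Xs m hc1 hc2 srho sel.
apply: (le_trans up).
apply: (@le_trans _ _ (((5 / ln 2 + K / rho) * L)%:E * (B + rho * D)%:E)%E).
  2: by apply: lee_wpmul2l => //; rewrite lee_fin ltW.
rewrite -EFinM lee_fin -/L.
have -> : (5 / ln 2 + K / rho) * L * (B + rho * D) =
    5 * N%:R * B + K * L * D + (5 * N%:R * rho * D + K / rho * L * B).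
  by rewrite lnE; field; rewrite !gt_eqF.
have -> : K * L = (2 + 2 * c2 + 320) * N%:R + 2 * c1 * L.
  by rewrite /K lnE; field; rewrite gt_eqF.
have h1 : 0 <= 5 * N%:R * rho * D + K / rho * L * B.
  rewrite addr_ge0 ?mulr_ge0 ?invr_ge0 ?(ltW rho0) ?lnE ?mulr_ge0 ?(ltW ln2) //; lra.
have h2 : B <= N%:R * B by rewrite ler_peMl.
have ND : N%:R <= N%:R * D by rewrite ler_peMr //; lra.
have DN : D <= N%:R * D by rewrite ler_peMl //; lra.
have h3 : c2 * D <= c2 * (N%:R * D) by apply: ler_wpM2l => //; lra.
rewrite -natr1.
lra.
Qed.
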